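(* Let $A$ be a set with $|A| = \aleph_0$, let $C$ be a constantive clone on $A$ with quasigroup operations, and let $m \in \mathbb{N}$. Then the following are equivalent: (1) $|(\operatorname{Pol}\operatorname{Inv} C)^{[1]}| \le \aleph_0$. (2) $C^{[1]}$ has a finite base of equality. (3) $C^{[m]}$ has a finite base of equality. (4) $|C| \le \aleph_0$ and there exists $d \in \mathbb{N}$ such that for all $n \in \mathbb{N}$: $C^{[n]} = (\operatorname{Pol}\operatorname{Inv}^{[d^n+1]} C)^{[n]}$. (5) $|C| \le \aleph_0$ and for all $n \in \mathbb{N}$ there exists $k \in \mathbb{N}$ with $C^{[n]} = (\operatorname{Pol}\operatorname{Inv}^{[k]} C)^{[n]}$. (6) $|C| \le \aleph_0$ and $C = \operatorname{Pol}\operatorname{Inv} C$.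
   Context: A clone on $A$ is a set of finitary operations on $A$ containing all projections and closed under composition. A clone is constantive if it contains all unary constant operations on $A$. For a clone $C$, $\operatorname{Inv} C$ is the set of all finitary relations on $A$ preserved by every function in $C$, and $\operatorname{Inv}^{[k]} C$ is the set of $k$-ary relations in $\operatorname{Inv} C$; for a set $R$ of relations, $\operatorname{Pol} R$ is the set of all finitary operations on $A$ preserving every relation in $R$. $F^{[n]}$ denotes the set of $n$-ary operations in $F$. $C$ is a clone with quasigroup operations if there are binary operations $\cdot, \backslash, / \in C$ such that $(A; \cdot, \backslash, /)$ is a quasigroup. For $F \subseteq A^B$, a subset $D \subseteq B$ is a base of equality for $F$ if for all $f,g\in F$ with $f|_D = g|_D$ we have $f = g$ (here $C^{[n]} \subseteq A^{A^n}$). *)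

(* Defs.v *)
From mathcomp Require Import all_boot.
From mathcomp Require Import classical_sets cardinality.

Set Implicit Arguments.
Unset Strict Implicit.
Unset Printing Implicit Defensive.

Local Open Scope classical_set_scope.

(* Arities are positive throughout: nullary operations and relations belong to
   the sigma types below but are excluded from clones, [InvRel] and [Pol]. *)

Definition op (A : Type) (n : nat) : Type := ('I_n -> A) -> A.

Definition operation (A : Type) : Type := {n : nat & op A n}.

Definition relation (A : Type) : Type := {k : nat & set ('I_k -> A)}.

Definition mkop (A : Type) (n : nat) (f : op A n) : operation A :=
  existT (op A) n f.

(* [ary n F] is F^[n]. *)
Definition ary (A : Type) (n : nat) (F : set (operation A)) : set (op A n) :=
  [set f | F (mkop f)].
Arguments ary {A} n F.

Definition op_proj (A : Type) (n : nat) (i : 'I_n) : op A n := fun x => x i.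

Definition op_comp (A : Type) (n k : nat) (f : op A n) (g : 'I_n -> op A k) :
  op A k := fun x => f (fun i => g i x).

Definition is_clone (A : Type) (C : set (operation A)) : Prop :=
  [/\ forall f : operation A, C f -> 0 < projT1 f,
      forall (n : nat) (i : 'I_n), ary n C (op_proj i)
    & forall (n k : nat) (f : op A n) (g : 'I_n -> op A k),
        ary n C f -> (forall i, ary k C (g i)) -> ary k C (op_comp f g)].

Definition constantive (A : Type) (C : set (operation A)) : Prop :=
  forall a : A, ary 1 C (fun=> a).

Definition binop (A : Type) (h : A -> A -> A) : op A 2 :=
  fun x => h (x ord0) (x ord_max).

Definition is_quasigroup (A : Type) (mul ldiv rdiv : A -> A -> A) : Prop :=
  [/\ forall x y, mul x (ldiv x y) = y,
      forall x y, ldiv x (mul x y) = y,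
      forall x y, mul (rdiv x y) y = x
    & forall x y, rdiv (mul x y) y = x].

Definition has_quasigroup_operations (A : Type) (C : set (operation A)) : Prop :=
  exists mul ldiv rdiv : A -> A -> A,
    [/\ ary 2 C (binop mul), ary 2 C (binop ldiv), ary 2 C (binop rdiv)
      & is_quasigroup mul ldiv rdiv].

Definition preserves (A : Type) (f : operation A) (R : relation A) : Prop :=
  forall r : 'I_(projT1 f) -> 'I_(projT1 R) -> A,
    (forall i, projT2 R (r i)) -> projT2 R (fun j => projT2 f (fun i => r i j)).

Definition InvRel (A : Type) (C : set (operation A)) : set (relation A) :=
  [set R | 0 < projT1 R /\ forall f, C f -> preserves f R].

(* [InvRel_ k C] is the set of k-ary members of [InvRel C]. *)
Definition InvRel_ (A : Type) (k : nat) (C : set (operation A)) :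
  set (relation A) := [set R | InvRel C R /\ projT1 R = k].
Arguments InvRel_ {A} k C.

Definition Pol (A : Type) (Rs : set (relation A)) : set (operation A) :=
  [set f | 0 < projT1 f /\ forall R, Rs R -> preserves f R].

Definition base_of_equality (A B : Type) (F : set (B -> A)) (D : set B) : Prop :=
  forall f g : B -> A, F f -> F g -> (forall x, D x -> f x = g x) -> f = g.

Definition has_finite_base_of_equality (A B : Type) (F : set (B -> A)) : Prop :=
  exists D : set B, finite_set D /\ base_of_equality F D.

(* Main.v *)
Require Import Defs.
From mathcomp Require Import all_boot.
From mathcomp Require Import boolp classical_sets cardinality.

(** (1) => (2): [Pol (InvRel C)] is the closure of [C] for pointwise convergence.
    The term t(x,y,z) = (x / (y \ y)) * (y \ z) satisfies t(x,y,z) = x iff y = z,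
    so two distinct unary members of [C] agreeing on a finite set D let one move
    any member off itself without changing it on D. If no finite set is a base
    of equality, the unary part of [C] thus has no isolated point, and its
    closure in A^A is uncountable by diagonalization.

    (2) => (4): a base of equality D of size d for the unary part yields the
    base D^n for the n-ary part, varying one coordinate at a time and freezing
    the others at constants. Members of [Pol (InvRel_ (d ^ n + 1) C)] are
    interpolated by [C] on D^n together with any one further point, and all
    these interpolants coincide. *)

Local Open Scope classical_set_scope.
Local Open Scope card_scope.

(** * Diagonalization in a closed set without isolated points *)

Lemma inj_on_left_inverse (T : Type) (x0 : T) (D : set T) (phi : T -> nat) :
  {in D &, injective phi} -> exists e : nat -> T, forall x, D x -> e (phi x) = x.
Proof.
move=> phi_inj.
have /choice[e eP] : forall n, exists y, forall x, D x -> phi x = n -> y = x.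
  move=> n; have [[y [Dy yn]]|noy] := EM (exists y, D y /\ phi y = n).
    by exists y => x Dx xn; apply: phi_inj; rewrite ?inE // xn.
  by exists x0 => x Dx xn; case: noy; exists x.
by exists e => x Dx; apply: (eP (phi x)).
Qed.

Lemma neq_pointwise (A B : Type) (f g : B -> A) :
  f <> g -> exists x, f x <> g x.
Proof. by move=> neq; apply/existsNP => eqfg; apply: neq; apply/funext. Qed.

(** Given an injective coding of [G] by naturals, stage [n] picks a member of [F] and a longer
    frozen prefix of the enumeration [e], on which it differs from the member of [G] coded [n]. The
    limit is in [G] by closedness, yet differs from itself at the stage of its own code. *)
Lemma perfect_closure_uncountable (A B : Type) (e : nat -> B)
    (F G : set (B -> A)) (h0 : B -> A) :
  (forall b, exists n, e n = b) -> F h0 ->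
  (forall h N, F h -> exists h',
     [/\ F h', h' <> h & forall i, i < N -> h' (e i) = h (e i)]) ->
  (forall f, (forall N, exists g, F g /\ forall i, i < N -> g (e i) = f (e i)) ->
     G f) ->
  ~ countable G.
Proof.
move=> /choice[c cK] Fh0 perfect closed /countable_injP[phi phi_inj].
(* Only one member of [G] can have code [n]; [h] is perturbed exactly when it is that member. *)
have avoid n h N : F h -> exists h', [/\ F h',
    forall i, i < N -> h' (e i) = h (e i) & forall f, G f -> phi f = n -> f <> h'].
  move=> Fh; have [[Gh hn]|Nh] := EM (G h /\ phi h = n).
    have [h' [Fh' neq agree]] := perfect h N Fh.
    exists h'; split=> // f Gf fn fh'; apply: neq.
    by rewrite -fh'; apply: phi_inj; rewrite ?inE // fn.
  by exists h; split=> // f Gf fn fh; apply: Nh; rewrite -fh.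
(* A state pairs the current function with the length of its frozen prefix. The new length exceeds
   the old one and covers a point [b] witnessing the difference. *)
have /choice[step stepP] : forall s : nat * ((B -> A) * nat), exists t, F s.2.1 ->
    [/\ F t.1, s.2.2 < t.2, forall i, i < s.2.2 -> t.1 (e i) = s.2.1 (e i)
      & forall f, G f -> phi f = s.1 ->
          exists2 p, p < t.2 & f (e p) <> t.1 (e p)].
  move=> [n [h N]] /=; have [Fh|NFh] := EM (F h); last by exists (h, N).
  have [h' [Fh' agree nG]] := avoid n h N Fh.
  have [[f0 [Gf0 f0n]]|nof] := EM (exists f, G f /\ phi f = n); last first.
    by exists (h', N.+1); split=> // f Gf fn; case: nof; exists f.
  have [b neqb] := neq_pointwise _ _ _ _ (nG _ Gf0 f0n).
  exists (h', (maxn N (c b)).+1); split=> //= [|f Gf fn].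
    by rewrite ltnS leq_maxl.
  exists (c b); first by rewrite ltnS leq_maxr.
  by rewrite cK (_ : f = f0) //; apply: phi_inj; rewrite ?inE // fn.
pose st := fix st n := if n is n'.+1 then step (n', st n') else (h0, 0).
have stF n : F (st n).1 by elim: n => //= n IHn; case: (stepP (n, st n) IHn).
have stS n := stepP (n, st n) (stF n).
have st_ge n : n <= (st n).2.
  by elim: n => // n IHn; have [_ lt _ _] := stS n; apply: leq_ltn_trans lt.
have st_agree n k i : i < (st n).2 ->
    (st (n + k)).1 (e i) = (st n).1 (e i) /\ i < (st (n + k)).2.
  move=> lt_i; elim: k => [|k [IHe IHlt]]; first by rewrite addn0.
  rewrite addnS; have [_ lt agree _] := stS (n + k).
  by split; [rewrite -IHe; apply: agree | apply: ltn_trans lt].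
(* By [st_ge], stage [(c b).+1] has already frozen index [c b], so this is the limit value at
   [b]. *)
pose f b := (st (c b).+1).1 b.
have fE n i : i < (st n).2 -> f (e i) = (st n).1 (e i).
  (* The index [c (e i)] may differ from [i], so both values are compared at a common later
     stage. *)
  move=> lt_i; have [<- _] := st_agree n (c (e i)).+1 i lt_i.
  have [] := st_agree _ n (c (e i)) (st_ge (c (e i)).+1).
  by rewrite cK addnC.
have Gf : G f.
  apply: closed => N; exists (st N).1; split=> // i lt_i.
  by rewrite (fE N) // (leq_trans lt_i).
have [_ _ _ /(_ f Gf erefl)[p lt_p]] := stS (phi f).
by apply; apply: (fE (phi f).+1).
Qed.

(** * Invariant relations and interpolation by the clone *)

Lemma comp_binop (A : Type) (C : set (operation A)) (h : A -> A -> A) n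
    (f g : op A n) :
  is_clone C -> ary 2 C (binop h) -> ary n C f -> ary n C g ->
  ary n C (fun x => h (f x) (g x)).
Proof.
move=> [_ _ Ccomp] Ch Cf Cg.
by apply: (Ccomp 2 n (binop h) (fun i => if i == ord0 then f else g)) => // i;
  case: ifP.
Qed.

Lemma clone_sub_Pol (A : Type) (C : set (operation A)) (Rs : set (relation A)) :
  is_clone C -> Rs `<=` InvRel C -> C `<=` Pol Rs.
Proof.
move=> [Cpos _ _] sub f Cf; split; first exact: Cpos.
by move=> R /sub[_]; apply.
Qed.

(** The rows [r i] of a [k]-ary relation form a matrix with [k] columns; a member of [C] that agrees
    with [f] on these columns sends the rows to the same tuple. *)
Lemma Pol_InvRel_interpolated (A : Type) (C : set (operation A)) n (f : op A n) :
  0 < n ->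
  (forall k (x : 'I_k -> 'I_n -> A),
     exists2 g, ary n C g & forall j, g (x j) = f (x j)) ->
  ary n (Pol (InvRel C)) f.
Proof.
move=> n_gt0 interp; split=> // -[k R] [_ invR] /= r rR.
have [g Cg gf] := interp k (fun j i => r i j).
rewrite (_ : (fun j => _) = (fun j => g (fun i => r i j))).
  exact: (invR _ Cg).
by apply/funext => j; rewrite gf.
Qed.

Lemma interpolated_Pol_InvRel_ (A : Type) (C : set (operation A)) n k
    (f : op A n) (x : 'I_k -> 'I_n -> A) :
  is_clone C -> 0 < k -> ary n (Pol (InvRel_ k C)) f ->
  exists2 g, ary n C g & forall j, g (x j) = f (x j).
Proof.
move=> [_ Cproj Ccomp] k_gt0 [_ fpol].
(* [R] is the subalgebra of the [k]-th power of [A] generated by the [n] rows of the matrix [x];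
   applying [f] to these generators stays in [R]. *)
pose R : relation A :=
  existT _ k [set y | exists2 g, ary n C g & forall j, g (x j) = y j].
have invR : InvRel_ k C R.
  split=> //; split=> // -[p q] Cq r /= rR.
  have /choice[g gP] : forall i, exists g, ary n C g /\ forall j, g (x j) = r i j.
    by move=> i; have [g Cg gx] := rR i; exists g.
  exists (op_comp q g) => [|j]; first by apply: Ccomp => // i; have [] := gP i.
  by congr q; apply/funext => i; have [_] := gP i.
have [|g Cg gf] := fpol R invR (fun i j => x j i).
  by move=> i; exists (op_proj i).
by exists g => // j; rewrite gf.
Qed.

(** * Finite bases of equality and their powers *)

(** A finite base of equality for the unary part, listed as a tuple with repetitions allowed, so
    that its [n]-th power is indexed by [d ^ n] functions. *)
Definition separating_family (A : Type) (C : set (operation A)) d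
    (u : 'I_d -> A) : Prop :=
  forall f g : op A 1, ary 1 C f -> ary 1 C g ->
    (forall i, f (fun=> u i) = g (fun=> u i)) -> f = g.

(** Unary members of [C] become [m]-ary ones through the first coordinate, so the first coordinates
    of a base separate them. *)
Lemma finite_base_separating (A : Type) (C : set (operation A)) m :
  [set: A] #= [set: nat] -> is_clone C -> 0 < m ->
  has_finite_base_of_equality (ary m C) ->
  exists d (u : 'I_d -> A), 0 < d /\ separating_family A C d u.
Proof.
move=> cardA [_ Cproj Ccomp] m_gt0 [D [/finite_setP[n /card_set_bijP[phi]]]].
move=> [phi_lt phi_inj _ baseD].
have /card_bijP[b _] := card_esym cardA.
pose a0 : A := val (b (SigSub (mem_set (I : [set: nat] 0)))).
have [e eP] := inj_on_left_inverse _ (fun=> a0) D phi phi_inj.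
pose i0 := Ordinal m_gt0.
(* The extra index, where [e] has an arbitrary value, keeps [d] positive even if [D] is empty. *)
exists n.+1, (fun i => e i i0); split=> // f g Cf Cg fg.
have lift_unary h : ary 1 C h -> ary m C (op_comp h (fun=> op_proj i0)).
  by move=> Ch; apply: Ccomp => // _; apply: Cproj.
have eq_lift : op_comp f (fun=> op_proj i0) = op_comp g (fun=> op_proj i0).
  apply: baseD => [||x Dx]; [exact: lift_unary | exact: lift_unary |].
  have := fg (Ordinal (ltnW (phi_lt x Dx : phi x < n) : phi x < n.+1)).
  by rewrite /= eP.
apply/funext => x; rewrite (_ : x = fun=> x ord0).
  exact: (congr1 (fun h : op A m => h (fun=> x ord0)) eq_lift).
by apply/funext => i; rewrite ord1.
Qed.

Lemma separating_family_ary (A : Type) (C : set (operation A)) d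
    (u : 'I_d -> A) n (f g : op A n) :
  is_clone C -> constantive C -> separating_family A C d u ->
  ary n C f -> ary n C g ->
  (forall t : {ffun 'I_n -> 'I_d}, f (fun i => u (t i)) = g (fun i => u (t i))) ->
  f = g.
Proof.
move=> Cclone Cconst sep Cf Cg fg; have [_ Cproj Ccomp] := Cclone.
(* Induction on the number [j] of leading coordinates left free: [j = 0] is the hypothesis, [j = n]
   the goal. Coordinate [j] is freed by freezing the others at constants of [C], which gives unary
   members of [C]. *)
suff eq_from j : forall x, (forall i : 'I_n, j <= i -> exists k, x i = u k) ->
    f x = g x.
  by apply/funext => x; apply: (eq_from n) => i; rewrite leqNgt ltn_ord.
elim: j => [|j IHj] x xu.
  have /choice[t tP] := fun i => xu i (leq0n i).
  rewrite (_ : x = fun i => u ([ffun i => t i] i)) //.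
  by apply/funext => i; rewrite ffunE.
have [lt_jn|le_nj] := ltnP j n; last first.
  by apply: IHj => i /(leq_trans le_nj); rewrite leqNgt ltn_ord.
pose jn := Ordinal lt_jn.
pose slice (y : 'I_1 -> A) i := if i == jn then y ord0 else x i.
have Cslice h : ary n C h -> ary 1 C (fun y => h (slice y)).
  move=> Ch; pose c i : op A 1 := if i == jn then op_proj ord0 else fun=> x i.
  rewrite (_ : (fun y => _) = op_comp h c).
    by apply: Ccomp => // i; rewrite /c; case: ifP => // _; apply: Cproj.
  apply/funext => y; congr h; apply/funext => i.
  by rewrite /slice /c; case: ifP.
have eq_slice : (fun y => f (slice y)) = (fun y => g (slice y)).
  apply: sep => [||k]; [exact: Cslice | exact: Cslice |].
  apply: IHj => i le_ji; rewrite /slice; case: eqP => [_|/eqP neq].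
    by exists k.
  by apply: xu; rewrite ltn_neqAle le_ji andbT eq_sym.
have <- : slice (fun=> x jn) = x.
  by apply/funext => i; rewrite /slice; case: eqP => [->|].
exact: (congr1 (fun h : op A 1 => h (fun=> x jn)) eq_slice).
Qed.

Lemma separating_family_finite_base (A : Type) (C : set (operation A)) d
    (u : 'I_d -> A) n :
  is_clone C -> constantive C -> separating_family A C d u ->
  has_finite_base_of_equality (ary n C).
Proof.
move=> Cclone Cconst sep.
pose pt (t : {ffun 'I_n -> 'I_d}) i := u (t i).
exists [set pt t | t in [set: {ffun 'I_n -> 'I_d}]]; split.
  exact: finite_image finite_finset.
move=> f g Cf Cg fg; apply: (separating_family_ary A C d u) => // t.
by apply: fg; exists t.
Qed.

Lemma separating_family_countable (A : Type) (C : set (operation A)) d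
    (u : 'I_d -> A) :
  countable [set: A] -> is_clone C -> constantive C -> separating_family A C d u ->
  countable C.
Proof.
move=> /countable_injP[phi phi_inj] Cclone Cconst sep; apply/countable_injP.
pose code (f : operation A) :=
  [ffun t : {ffun 'I_(projT1 f) -> 'I_d} => phi (projT2 f (fun i => u (t i)))].
(* The type of the value table depends on the arity, so the table is first coded as a natural
   number; arities are compared before tables. *)
exists (fun f => pickle (projT1 f, pickle (code f))).
move=> [n f] [n' g]; rewrite !inE => Cf Cg.
move=> /(pcan_inj pickleK)/= [eq_n]; case: n' / eq_n in g Cg *.
move=> /(pcan_inj pickleK)/ffunP eq_code.
congr existT; apply: (separating_family_ary A C d u) => // t.
by have := eq_code t; rewrite !ffunE => /phi_inj; apply; rewrite inE.
Qed.

Lemma separating_family_Pol (A : Type) (C : set (operation A)) d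
    (u : 'I_d -> A) n :
  0 < d -> is_clone C -> constantive C -> separating_family A C d u ->
  ary n (Pol (InvRel_ (d ^ n + 1) C)) `<=` ary n C.
Proof.
move=> d_gt0 Cclone Cconst sep f fpol.
have card_dn : #|{ffun 'I_n -> 'I_d}| = d ^ n by rewrite card_ffun !card_ord.
pose base (j : 'I_(d ^ n)) i := u (enum_val (cast_ord (esym card_dn) j) i).
have interp x : exists g, [/\ ary n C g, g x = f x &
    forall t : {ffun 'I_n -> 'I_d}, g (fun i => u (t i)) = f (fun i => u (t i))].
  (* The [d ^ n] grid points, followed by the extra point [x]. *)
  pose pts (j : 'I_(d ^ n + 1)) := if split j is inl k then base k else x.
  have [|g Cg gf] := interpolated_Pol_InvRel_ A C n _ f pts Cclone _ fpol.
    by rewrite addn1.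
  have ptsl k : pts (lshift 1 k) = base k.
    by rewrite /pts (unsplitK (inl k : 'I_(d ^ n) + 'I_1)).
  have ptsr k : pts (rshift (d ^ n) k) = x.
    by rewrite /pts (unsplitK (inr k : 'I_(d ^ n) + 'I_1)).
  exists g; split=> // [|t]; first by rewrite -(ptsr ord0) gf.
  have -> : (fun i => u (t i)) = base (cast_ord card_dn (enum_rank t)).
    by apply/funext => i; rewrite /base cast_ordK enum_rankK.
  by rewrite -ptsl gf.
(* Any extra point would do here: only agreement on the grid is kept, and it forces every other
   interpolant to equal [g]. *)
have [g [Cg _ gf]] := interp (fun=> u (Ordinal d_gt0)).
rewrite (_ : f = g) //; apply/funext => x; have [h [Ch <- hf]] := interp x.
congr (_ x); apply: (separating_family_ary A C d u) => // t.
by rewrite gf hf.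
Qed.

(** * Perturbation by quasigroup terms, and the equivalences *)

Lemma quasigroup_perturbation (A : Type) (C : set (operation A)) n
    (h f g : op A n) :
  is_clone C -> has_quasigroup_operations C ->
  ary n C h -> ary n C f -> ary n C g -> f <> g ->
  exists2 h', ary n C h' & h' <> h /\ forall x, f x = g x -> h' x = h x.
Proof.
move=> Cclone [mul [ldiv [rdiv [Cmul Cldiv Crdiv [mulK ldivK rdivK _]]]]].
move=> Ch Cf Cg neq.
exists (fun x => mul (rdiv (h x) (ldiv (f x) (f x))) (ldiv (f x) (g x))).
  by do ?[apply: comp_binop => //].
(* If the new operation equals [h], cancelling the common left factor gives [f \ g = f \ f]
   pointwise, hence [g = f]. *)
split=> [eqh|x <-]; last exact: rdivK.
apply: neq; apply/funext => x.
have := congr1 (fun k : op A n => k x) eqh.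
rewrite /= -[RHS](rdivK (h x) (ldiv (f x) (f x))).
move=> /(congr1 (ldiv (rdiv (h x) (ldiv (f x) (f x))))); rewrite !ldivK.
by move=> /(congr1 (mul (f x))); rewrite !mulK.
Qed.

Lemma countable_Pol_finite_base (A : Type) (C : set (operation A)) :
  [set: A] #= [set: nat] -> is_clone C -> constantive C ->
  has_quasigroup_operations C -> countable (ary 1 (Pol (InvRel C))) ->
  has_finite_base_of_equality (ary 1 C).
Proof.
move=> cardA Cclone Cconst Cquasi; apply: contraPP => nobase.
have /card_bijP[b [b' _ bK]] := card_esym cardA.
pose e n : 'I_1 -> A := fun=> val (b (SigSub (mem_set (I : [set: nat] n)))).
have e_surj x : exists n, e n = x.
  exists (val (b' (SigSub (mem_set (I : [set: A] (x ord0)))))).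
  apply/funext => i; rewrite /e ord1.
  by rewrite (_ : SigSub _ = b' (SigSub (mem_set (I : [set: A] (x ord0)))));
    [rewrite bK | apply: val_inj].
apply: (@perfect_closure_uncountable _ _ e (ary 1 C) _ (fun=> e 0 ord0) e_surj).
- exact: Cconst.
- move=> h N Ch.
  (* The first [N] enumerated points form a finite set, hence not a base of equality. *)
  have [f [g [Cf Cg agree neq]]] : exists f g : op A 1,
      [/\ ary 1 C f, ary 1 C g, forall i, i < N -> f (e i) = g (e i) & f <> g].
    apply: contrapT => nofg; apply: nobase.
    exists (e @` `I_N); split; first exact: finite_image (finite_II N).
    move=> f g Cf Cg fg; apply: contrapT => neq; apply: nofg.
    by exists f, g; split=> // i lt_i; apply: fg; exists i.
  have [h' Ch' [neqh eqh]] :=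
    quasigroup_perturbation A C 1 h f g Cclone Cquasi Ch Cf Cg neq.
  by exists h'; split=> // i lt_i; apply/eqh/agree.
- move=> f interp; apply: Pol_InvRel_interpolated => // k x.
  have /choice[c cK] := fun j => e_surj (x j).
  (* This bound gives an initial segment of the enumeration containing all the points [x j]. *)
  have [g [Cg gf]] := interp (\max_j (c j).+1).
  exists g => // j; rewrite -(cK j) gf //.
  exact: (@leq_bigmax _ (fun j => (c j).+1) j).
Qed.

Theorem theorem5p3 (A : Type) (hA : [set: A] #= [set: nat])
  (C : set (operation A)) (hC : is_clone C) (hconst : constantive C)
  (hquasi : has_quasigroup_operations C) (m : nat) (hm : 0 < m) :
  [<-> countable (ary 1 (Pol (InvRel C)));
       has_finite_base_of_equality (ary 1 C);
       has_finite_base_of_equality (ary m C);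
       countable C /\
         exists d : nat, 0 < d /\
           forall n : nat, 0 < n ->
             ary n C = ary n (Pol (InvRel_ (d ^ n + 1) C));
       countable C /\
         forall n : nat, 0 < n ->
           exists k : nat, 0 < k /\ ary n C = ary n (Pol (InvRel_ k C));
       countable C /\ C = Pol (InvRel C)].
Proof.
have countA : countable [set: A] by rewrite /countable; case/card_eqPle: hA.
tfae.
- exact: countable_Pol_finite_base.
- move=> /(finite_base_separating A C 1 hA hC isT)[d [u [_ sep]]].
  exact: separating_family_finite_base sep.
- move=> /(finite_base_separating A C m hA hC hm)[d [u [d_gt0 sep]]].
  split; first exact: separating_family_countable sep.
  exists d; split=> // n n_gt0; apply/seteqP; split.
    by move=> f; apply: clone_sub_Pol => // R [].
  exact: separating_family_Pol sep.
- move=> [countC [d [d_gt0 eqC]]]; split=> // n n_gt0.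
  by exists (d ^ n + 1); rewrite addn1; split=> //; rewrite -addn1; apply: eqC.
- move=> [countC eqC]; split=> //; apply/seteqP; split.
    exact: clone_sub_Pol.
  move=> [n f] [n_gt0 fpol]; have [k [_ eqCk]] := eqC n n_gt0.
  suff: ary n C f by [].
  (* Preserving all invariant relations is stronger than preserving the [k]-ary ones, so
     [Pol (InvRel C)] falls into [C] at each arity. *)
  by rewrite eqCk; split=> // R [invR _]; apply: fpol.
- move=> [/countable_injP[phi phi_inj] <-]; apply/countable_injP.
  exists (fun f => phi (mkop f)) => f g; rewrite !inE => Cf Cg eq_fg.
  have eq_op : mkop f = mkop g by apply: phi_inj; rewrite ?inE.
  (* Equality of the dependent pairs is transported to their second components, using decidable
     equality of arities. *)
  have := congr1 (tagged_as (mkop f)) eq_op.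
  by rewrite !(tagged_asE (T_ := op A) (u := mkop f)).
Qed.
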